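(* Let $f:X\to Y$ be an onto and open mapping between continua, let $A\in 2^Y$ and let $n\in\mathbb N$. If $f^{-1}(A)\in NBO_n(X)$, then $A\in NBO_n(Y)$.
   Context: All spaces are metric; a mapping is a continuous function; a continuum is a compact connected space with more than one point; $\mathbb N=\{1,2,\dots\}$. For a non-empty space $Z$ and $n\in\mathbb N$: $2^Z$ is the set of non-empty compact subsets of $Z$; $F_n(Z)$ is the set of elements of $2^Z$ with at most $n$ points. A non-empty space $Z$ is $n$-$Qo$ if there exists $B\in F_n(Z)$ such that for every non-empty open set $U$ of $Z$ there exists a continuum $D\subset Z$ with $B\cap \mathrm{int}_Z(D)\neq\emptyset\neq \mathrm{int}_Z(D)\cap U$. For a non-degenerate compact metric space $Z$: $NBO_n(Z)=\{A\in 2^Z: A=Z$ or $Z-A$ is $n$-$Qo\}$. *)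

(* Defs.v *)
From HB Require Import structures.
From mathcomp Require Import all_boot all_order all_algebra.
From mathcomp Require Import all_classical all_reals.
From mathcomp Require Import topology.

Set Implicit Arguments.
Unset Strict Implicit.
Unset Printing Implicit Defensive.

Local Open Scope classical_set_scope.
Local Open Scope card_scope.

(* Spaces are represented as subsets Z of an ambient topological type T with
   the relative topology; Z = [set: T] gives the type T itself. *)
Section Definitions.
Context {T : topologicalType}.
Implicit Types Z A : set T.

Definition continuum Z : Prop :=
  [/\ compact Z, connected Z & exists x y, [/\ Z x, Z y & x <> y]].

(* The hyperspace 2^Z. *)
Definition hyperspace Z : set (set T) :=
  [set K | [/\ K `<=` Z, K !=set0 & compact K]].

(* F_n(Z). *)
Definition sym_product (n : nat) Z : set (set T) :=
  [set B | hyperspace Z B /\ B #<= `I_n].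

(* The points outside Z are isolated in [subspace Z], but the subsets of Z
   have the same open subsets and the same interior there as in Z. *)
Definition nQo (n : nat) Z : Prop :=
  Z !=set0 /\
  exists2 B, sym_product n Z B &
    forall U, U `<=` Z -> @open (subspace Z) U -> U !=set0 ->
      exists D, [/\ D `<=` Z, continuum D,
        B `&` @interior (subspace Z) D !=set0 &
        @interior (subspace Z) D `&` U !=set0].

Definition NBO (n : nat) Z : set (set T) :=
  [set A | hyperspace Z A /\ (A = Z \/ nQo n (Z `\` A))].

End Definitions.

Definition open_map (S T : topologicalType) (f : S -> T) : Prop :=
  forall U, open U -> open (f @` U).

(* Main.v *)
Require Import Defs.
From mathcomp Require Import all_boot all_order all_algebra.
From mathcomp Require Import all_classical all_reals.
From mathcomp Require Import topology.

Local Open Scope classical_set_scope.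

(** Being [nQo n] passes from an open subset [Z] of the domain to its image
    under a continuous open map: if [B] witnesses it for [Z], then [f @` B]
    witnesses it for [f @` Z], because a continuum [D] joining [B] to
    [Z `&` f @^-1` U] is sent to a continuum joining [f @` B] to [U], and
    openness of [f] carries the interior of [D] into the interior of its image.
    The only danger is that [f] collapses [D] to a point; but that point would
    then be open, as the image of the non-empty interior of [D], and a
    continuum has no isolated point ([continuum_image], [continuum_no_isolated]).

    The complement of [A] is open, as [A] is compact, and is the image of the
    complement of [f @^-1` A], as [f] is onto; so [nQo_image] applies to it. *)

(** For an open [Z] the interiors relative to [Z] are the interiors in the
    ambient space, the only ones to which openness of a map applies. *)
Lemma interior_open_subspace (T : topologicalType) (Z D : set T) :
  open Z -> D `<=` Z -> @interior (subspace Z) D = D°.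
Proof.
move=> oZ DZ; apply/seteqP; split => x xD.
- have Zx : (Z°) x.
    by rewrite (iffLR (interior_id Z) oZ); apply: DZ; exact: nbhs_singleton xD.
  by move: xD; rewrite /interior /= -(nbhs_subspace_interior Zx).
- have Zx : (Z°) x by apply: filterS xD.
  by move: xD; rewrite /interior /= (nbhs_subspace_interior Zx).
Qed.

Lemma open_open_subspace (T : topologicalType) (Z U : set T) :
  open Z -> U `<=` Z -> @open (subspace Z) U -> open U.
Proof.
move=> oZ UZ /open_subspaceP[V oV VZ].
by rewrite -(setIidl UZ) -VZ; exact: openI.
Qed.

Lemma open_map_interior (S T : topologicalType) (f : S -> T) (D : set S) :
  open_map f -> f @` D° `<=` (f @` D)°.
Proof.
move=> f_open; rewrite -open_subsetE.
  exact: image_subset (@interior_subset _ D).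
by apply: f_open; exact: open_interior.
Qed.

(** An open point would be clopen, hence the whole space. *)
Lemma continuum_no_isolated (T : topologicalType) :
  hausdorff_space T -> continuum [set: T] -> forall y : T, ~ open [set y].
Proof.
move=> hT [_ cT [a [b [_ _ ab]]]] y oy.
have /seteqP[_ yT] : [set y] = [set: T].
  apply: cT; first by exists y.
    by exists [set y]; rewrite ?setTI.
  exists [set y]; rewrite ?setTI//.
  exact/accessible_closed_set1/hausdorff_accessible.
by apply: ab; rewrite (yT a I) (yT b I).
Qed.

(** Non-degeneracy of the image is where openness of [f] matters: if [f @` D]
    were a point, that point would be [f @` D°], an open set. *)
Lemma continuum_image (S T : topologicalType) (f : S -> T) (D : set S) :
  continuous f -> open_map f -> (forall y : T, ~ open [set y]) ->
  D° !=set0 -> continuum D -> continuum (f @` D).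
Proof.
move=> f_cont f_open noiso [x xD] [kD cD _]; split.
- by apply: continuous_compact kD; exact: continuous_subspaceT.
- by apply: connected_continuous_connected cD _; exact: continuous_subspaceT.
- have Dx := interior_subset xD.
  apply: contrapT => degen; apply: (noiso (f x)).
  rewrite (_ : [set f x] = f @` D°); first exact/f_open/open_interior.
  apply/seteqP; split=> [_ -> | _ [z /interior_subset Dz <-]]; first by exists x.
  apply: contrapT => fzx; apply: degen.
  by exists (f z), (f x); split.
Qed.

Lemma sym_product_image (S T : topologicalType) (f : S -> T) (n : nat)
    (Z B : set S) :
  continuous f -> sym_product n Z B -> sym_product n (f @` Z) (f @` B).
Proof.
move=> f_cont [[BZ [b Bb] kB] cB]; split.
- split; first exact: image_subset.
    by exists (f b), b.
  by apply: continuous_compact kB; exact: continuous_subspaceT.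
- exact: card_le_trans (card_image_le f B) cB.
Qed.

Lemma nQo_image (S T : topologicalType) (f : S -> T) (n : nat) (Z : set S) :
  continuous f -> open_map f -> (forall y : T, ~ open [set y]) ->
  open Z -> nQo n Z -> nQo n (f @` Z).
Proof.
move=> f_cont f_open noiso oZ [[z Zz] [B BZ Bjoin]].
have oW := f_open _ oZ.
split; first by exists (f z), z.
exists (f @` B); first exact: sym_product_image.
move=> U UW /(open_open_subspace _ _ _ oW UW) oU [u Uu].
have [x Zx fxu] := UW u Uu.
have oV : open (Z `&` f @^-1` U).
  by apply: openI => //; apply: open_comp => // ? _; exact: f_cont.
have [||D [DZ cD]] := Bjoin (Z `&` f @^-1` U) (@subIsetl _ _ _).
- exact: open_subspaceW.
- by exists x; split => //=; rewrite fxu.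
rewrite interior_open_subspace// => -[b [Bb bD]] [d [dD [_ Ud]]].
have fDW : f @` D `<=` f @` Z by exact: image_subset.
exists (f @` D); rewrite interior_open_subspace//; split => //.
- by apply: continuum_image => //; exists b.
- by exists (f b); split; [exists b | apply: open_map_interior => //; exists b].
- by exists (f d); split => //; apply: open_map_interior => //; exists d.
Qed.

Theorem proposition4p4 (R : realType) (X Y : metricType R)
  (hX : continuum [set: X]) (hY : continuum [set: Y])
  (f : X -> Y) (f_cont : continuous f)
  (f_onto : set_surj [set: X] [set: Y] f) (f_open : open_map f)
  (A : set Y) (hA : hyperspace [set: Y] A) (n : nat) (hn : (0 < n)%N) :
  NBO n [set: X] (f @^-1` A) -> NBO n [set: Y] A.
Proof.
have image_preimage_f (C : set Y) : f @` (f @^-1` C) = C.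
  apply: image_preimage; apply/seteqP; split=> // y _; exact: f_onto.
move=> [_ fA]; split=> //; case: fA => [fA | fA].
- left; rewrite -(image_preimage_f A) fA.
  by rewrite -(preimage_setT f) image_preimage_f.
right; have oA : open (~` A).
  case: hA => _ _ kA; apply: closed_openC.
  by apply: compact_closed => //; exact: metric_hausdorff.
rewrite setTD -(image_preimage_f (~` A)); apply: nQo_image => //.
- by apply: continuum_no_isolated => //; exact: metric_hausdorff.
- by apply: open_comp => // ? _; exact: f_cont.
- by rewrite preimage_setC -setTD.
Qed.
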